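(* Let $(M,d)$ be the countable metric space defined in the context. Let $X$ be a Banach space and suppose that there exist $D\in[1,2)$ and a map $f:M\to X$ such that $$d(x,y)\le\|f(x)-f(y)\|\le D\,d(x,y)\qquad\text{for all }x,y\in M.$$ Then $X$ contains a copy of $\ell_1$, i.e. a closed linear subspace linearly isomorphic to $\ell_1$.
   Context: $\mathbb N=\{1,2,3,\dots\}$. The metric space $(M,d)$: let $F=\{A\subset\mathbb N: 1\le |A|<\infty\}$ be the set of all finite nonempty subsets of $\mathbb N$, and let $M=\{\emptyset\}\cup\mathbb N\cup F$ (the three pieces are regarded as pairwise disjoint). Make $M$ into a graph by putting an edge between $\emptyset$ and every $n\in\mathbb N$, and an edge between $n\in\mathbb N$ and $A\in F$ exactly when $n\in A$; there are no other edges. The metric $d$ is the shortest path metric of this graph. Explicitly, for $n\ne m$ in $\mathbb N$ and $A\neq B$ in $F$: $d(\emptyset,n)=1$; $d(n,m)=2$; $d(n,A)=1$ if $n\in A$ and $d(n,A)=3$ if $n\notin A$; $d(\emptyset,A)=2$; $d(A,B)=2$ if $A\cap B\ne\emptyset$ and $d(A,B)=4$ if $A\cap B=\emptyset$. *)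

(* Defs.v *)
From HB Require Import structures.
From mathcomp Require Import all_boot all_order all_algebra finmap.
From mathcomp Require Import all_classical all_reals all_analysis.
Set Implicit Arguments.
Unset Strict Implicit.
Unset Printing Implicit Defensive.
Import Order.TTheory GRing.Theory Num.Theory.
Import numFieldNormedType.Exports.
Local Open Scope classical_set_scope.
Local Open Scope ring_scope.

Definition posnat := {n : nat | (0 < n)%N}.

Definition finsubset := {A : {fset posnat} | A != fset0}.

(* [Root] is the vertex written as the empty set; it is not a [Fin]. *)
Inductive M := Root | Pt of posnat | Fin of finsubset.

Definition edge : rel M := fun x y =>
  match x, y with
  | Root, Pt _ | Pt _, Root => true
  | Pt n, Fin A | Fin A, Pt n => n \in val A
  | _, _ => false
  end.

Definition walk (x y : M) (k : nat) : Prop :=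
  exists p : seq M, [/\ path edge x p, last x p = y & size p = k].

(* Closed form of the graph distance, see [gdistE]. *)
Definition dist_closed_form (x y : M) : nat :=
  (match x, y with
  | Root, Root => 0
  | Root, Pt _ | Pt _, Root => 1
  | Root, Fin _ | Fin _, Root => 2
  | Pt n, Pt m => if n == m then 0 else 2
  | Pt n, Fin A | Fin A, Pt n => if n \in val A then 1 else 3
  | Fin A, Fin B =>
      if A == B then 0 else if val A `&` val B != fset0 then 2 else 4
  end)%N%fset.

Lemma walk_dist_closed_form x y : walk x y (dist_closed_form x y).
Proof.
have finP (A : finsubset) : exists n, n \in val A.
  by case: A => A /= /fset0Pn.
case: x => [|n|A]; case: y => [|m|B] /=.
- by exists [::].
- by exists [:: Pt m].
- by have [n nB] := finP B; exists [:: Pt n; Fin B]; rewrite /= nB.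
- by exists [:: Root].
- by case: eqVneq => [->|_]; [exists [::] | exists [:: Root; Pt m]].
- case: ifPn => nB; first by exists [:: Fin B]; rewrite /= nB.
  have [k kB] := finP B.
  by exists [:: Root; Pt k; Fin B]; rewrite /= kB.
- by have [n nA] := finP A; exists [:: Pt n; Root]; rewrite /= nA.
- case: ifPn => mA; first by exists [:: Pt m]; rewrite /= mA.
  have [k kA] := finP A.
  by exists [:: Pt k; Root; Pt m]; rewrite /= kA.
- case: eqVneq => [->|_]; first by exists [::].
  case: ifPn => [/fset0Pn[k]|_].
    rewrite inE => /andP[kA kB].
    by exists [:: Pt k; Fin B]; rewrite /= kA kB.
  have [n nA] := finP A; have [m mB] := finP B.
  by exists [:: Pt n; Root; Pt m; Fin B]; rewrite /= nA mB.
Qed.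

Lemma walk_ex x y : exists k, `[< walk x y k >].
Proof.
exists (dist_closed_form x y); apply/asboolP.
exact: walk_dist_closed_form.
Qed.

Definition gdist (x y : M) : nat := ex_minn (walk_ex x y).

Lemma dist_closed_form_edge x y z :
  edge x z -> (dist_closed_form x y <= (dist_closed_form z y).+1)%N.
Proof.
case: x => [|n|A]; case: z => [|k|C] //=; case: y => [|m|B] //= h.
all: repeat case: ifP => //.
- by move=> /eqP CB; rewrite -CB h.
- by move=> /eqP km; rewrite -km h.
- move=> kB /negbFE/eqP AB0 _.
  have : k \in (val A `&` val B)%fset by rewrite in_fsetI h.
  by rewrite AB0.
Qed.

Lemma dist_closed_form_le x y k : walk x y k -> (dist_closed_form x y <= k)%N.
Proof.
case=> p [+ + <-]; elim: p x => [x _ <-|z p IH x /= /andP[xz zp] lp].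
  by case: x => //= *; rewrite eqxx.
by apply: (leq_trans (dist_closed_form_edge y xz)); rewrite ltnS; exact: IH.
Qed.

Lemma gdistE x y : gdist x y = dist_closed_form x y.
Proof.
rewrite /gdist; case: ex_minnP => k /asboolP wk kmin; apply/eqP.
rewrite eqn_leq dist_closed_form_le// andbT.
by apply: kmin; apply/asboolP; exact: walk_dist_closed_form.
Qed.

Section ell1.
Variable R : realType.

Definition abs_series (a : nat -> R) : R^nat := series (fun n => `|a n|).

Definition absum : {pred nat -> R^o} :=
  fun a => `[< cvgn (abs_series a) >].

Lemma absumP a : reflect (cvgn (abs_series a)) (a \in absum).
Proof. exact: asboolP. Qed.

Lemma abs_seriesZ (r : R) (a : nat -> R^o) :
  abs_series (r *: a) = `|r| \*: abs_series a.
Proof.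
apply/funext => n; rewrite /abs_series /series/= /GRing.scale/= mulr_sumr.
by apply: eq_bigr => i _; rewrite -normrM.
Qed.

Lemma absum_submod_closed : submod_closed absum.
Proof.
split=> [|r a b /absumP ca /absumP cb]; apply/absumP.
  rewrite (_ : abs_series _ = cst 0); first exact: is_cvg_cst.
  apply/funext => n; rewrite /abs_series /series/= big1// => i _.
  exact: normr0.
apply: (@series_le_cvg _ _ ((fun n => `|(r *: a) n|) \+ (fun n => `|b n|))).
- by move=> n; exact: normr_ge0.
- by move=> n; rewrite addr_ge0.
- by move=> n; exact: ler_normD.
- rewrite [X in cvgn X](_ : _ = abs_series (r *: a) \+ abs_series b); last first.
    by apply/funext => n; rewrite /abs_series /series/= big_split.
  by apply: is_cvgD => //; rewrite abs_seriesZ; exact: is_cvgZr.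
Qed.

HB.instance Definition _ :=
  GRing.isSubmodClosed.Build R (nat -> R^o) absum absum_submod_closed.

Record ell1 := Ell1 { ell1_seq :> nat -> R^o; _ : ell1_seq \in absum }.
HB.instance Definition _ := [isSub for ell1_seq].
HB.instance Definition _ := [Choice of ell1 by <:].
HB.instance Definition _ := [SubChoice_isSubLmodule of ell1 by <:].

Definition ell1_norm (a : ell1) : R := limn (abs_series a).

Lemma ell1_cvg (a : ell1) : cvgn (abs_series a).
Proof. exact/absumP/valP. Qed.

Lemma ell1_normD (a b : ell1) : ell1_norm (a + b) <= ell1_norm a + ell1_norm b.
Proof.
rewrite /ell1_norm -limD; [|exact: ell1_cvg..].
apply: ler_lim; [exact: ell1_cvg|apply: is_cvgD; exact: ell1_cvg|].
near=> n; rewrite [leRHS](_ : _ = \sum_(0 <= i < n) (`|a i| + `|b i|));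
  last first.
  by rewrite big_split.
by apply: ler_sum => i _; exact: ler_normD.
Unshelve. all: by end_near. Qed.

Lemma ell1_normZ (r : R) (a : ell1) : ell1_norm (r *: a) = `|r| * ell1_norm a.
Proof.
rewrite /ell1_norm [abs_series _](abs_seriesZ r a).
by rewrite limZr//; exact: ell1_cvg.
Qed.

Lemma ell1_norm0_eq0 (a : ell1) : ell1_norm a = 0 -> a = 0.
Proof.
move=> a0; apply/val_inj/funext => n /=; apply/eqP; rewrite -normr_le0 -a0.
have nd : nondecreasing_seq (abs_series a).
  by apply: nondecreasing_series => i _ _.
apply: (le_trans _ (nondecreasing_cvgn_le nd (@ell1_cvg a) n.+1)).
by rewrite /abs_series /series/= big_nat_recr//= lerDr sumr_ge0.
Qed.

HB.instance Definition _ := @Lmodule_isNormed.Build R ell1 ell1_norm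
  ell1_normD ell1_normZ ell1_norm0_eq0.

End ell1.

Section copy.
Variables (R : realType) (V X : normedModType R).

Definition linear_subspace (Y : set X) : Prop :=
  Y 0 /\ forall (r : R) (u v : X), Y u -> Y v -> Y (r *: u + v).

(* [T] is a linear homeomorphism of [V] onto [Y]; [S] is its inverse on [Y]. *)
Definition linearly_isomorphic_to (Y : set X) : Prop :=
  exists (T : {linear V -> X}) (S : X -> V),
    [/\ range T = Y, cancel T S, continuous T & {within Y, continuous S}].

Definition contains_copy : Prop :=
  exists Y : set X, [/\ closed Y, linear_subspace Y & linearly_isomorphic_to Y].

End copy.

(* Main.v *)
(* If N vertices p_i are all distinct from the N vertices q_i, the sets
   A = {p_i} and B = {q_i} are at distance 4, each p_i is at distance 1 from A
   and each q_i at distance 1 from B. Averaging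
     f A - f B = (f A - f p_i) + (f p_i - f q_i) + (f q_i - f B)
   with weights b_i >= 0 gives
     |sum b_i (f p_i - f q_i)| >= (4 - 2 D) sum b_i.
   A combination with signed coefficients a_i of y_i = f (2 i + 2) - f (2 i + 1)
   has this form with b_i = |a_i|, after exchanging the two points wherever
   a_i < 0. Hence (y_i) is a bounded sequence with a lower l1-estimate, and
   a |-> sum a_i y_i embeds l1 in X. *)
From HB Require Import structures.
Require Import Defs.
From mathcomp Require Import all_boot all_order all_algebra finmap.
From mathcomp Require Import all_classical all_reals all_analysis.
From mathcomp Require Import zify lra.
Set Implicit Arguments.
Unset Strict Implicit.
Unset Printing Implicit Defensive.
Import Order.TTheory GRing.Theory Num.Theory.
Import numFieldNormedType.Exports.
Local Open Scope ring_scope.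

(** * The space [ell1]: partial sums and completeness *)

Lemma ell1_norm_ge_sum (R : realType) (a : ell1 R) (N : nat) :
  \sum_(0 <= i < N) `|a i| <= `|a|.
Proof.
apply: (@nondecreasing_cvgn_le _ (abs_series a)); last exact: ell1_cvg.
by apply: nondecreasing_series => i _ _.
Qed.

Lemma ell1_norm_ge_coord (R : realType) (a : ell1 R) (n : nat) :
  `|a n| <= `|a|.
Proof.
apply: le_trans (ell1_norm_ge_sum a n.+1).
by rewrite big_nat_recr//= lerDr sumr_ge0.
Qed.

Lemma ell1_norm_le (R : realType) (a : ell1 R) (e : R) :
  (forall N, \sum_(0 <= i < N) `|a i| <= e) -> `|a| <= e.
Proof.
move=> ae; apply: limr_le; first exact: ell1_cvg.
by near=> N; exact: ae.
Unshelve. all: by end_near. Qed.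

Lemma absum_bounded (R : realType) (b : nat -> R^o) (e : R) :
  (forall N, \sum_(0 <= i < N) `|b i| <= e) -> b \in @absum R.
Proof.
move=> be; apply/absumP/nondecreasing_is_cvgn.
  by apply: nondecreasing_series => i _ _.
by exists e => _ [N _ <-]; exact: be.
Qed.

Local Open Scope classical_set_scope.

(** A norm-Cauchy sequence converges in each coordinate. The limit [b] is also the norm limit, since
    the Cauchy bounds on partial sums are uniform in the length [m] and survive the passage to the
    limit. *)
Lemma ell1_cvg_of_cauchy (R : realType) (u : nat -> ell1 R) :
  cauchy (u @ \oo) -> cvgn u.
Proof.
move=> /cauchy_ballP cu.
have cu' e : 0 < e -> exists N, forall k l, (N <= k)%N -> (N <= l)%N ->
    `|u k - u l| < e.
  move=> /cu [[A B]]/= [[N1 _ AN1] [N2 _ BN2]] ABe.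
  exists (maxn N1 N2) => k l; rewrite !geq_max => /andP[? ?] /andP[? ?].
  have := ABe (u k, u l) (conj (AN1 k _) (BN2 l _)); rewrite -ball_normE /=.
  by apply.
have cn n : cvgn (fun k => u k n : R).
  apply/cauchy_cvgP/cauchy_ballP => e e0.
  have [N uN] := cu' _ e0.
  exists ([set x | exists2 k, (N <= k)%N & u k n = x],
          [set x | exists2 k, (N <= k)%N & u k n = x]).
    by split; exists N => // k /= Nk; exists k.
  move=> [_ _] /= [[k Nk <-] [l Nl <-]]; rewrite -ball_normE /=.
  exact: le_lt_trans (ell1_norm_ge_coord (u k - u l) n) (uN _ _ Nk Nl).
pose b n : R^o := limn (fun k => u k n : R).
have ub e : 0 < e -> exists N, forall k, (N <= k)%N ->
    forall m, \sum_(0 <= i < m) `|u k i - b i| <= e.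
  move=> e0; have [N uN] := cu' _ e0; exists N => k Nk m.
  (* Here [k] and [m] are fixed and [l] tends to infinity: a finite sum depends continuously on its
     terms. *)
  have cb : \sum_(0 <= i < m) `|u k i - u l i| @[l --> \oo] -->
      \sum_(0 <= i < m) `|u k i - b i|.
    apply: cvg_big => [|i _]; first exact: add_continuous.
    by apply: cvg_norm; apply: cvgB; [exact: cvg_cst | exact: cn].
  rewrite -(cvg_lim _ cb)//; apply: limr_le.
    by apply/cvg_ex; eexists; exact: cb.
  near=> l; apply: le_trans (ell1_norm_ge_sum (u k - u l) m) _.
  by apply: ltW; apply: uN => //; near: l; exists N.
have babs : b \in @absum R.
  (* With [e = 1], the difference [u N - b] is summable, hence so is [b = u N - (u N - b)]. *)
  have [N /(_ N (leqnn _)) uN] := ub _ ltr01.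
  have dabs : ((u N : nat -> R^o) - b) \in @absum R by exact: absum_bounded uN.
  by rewrite -(subKr (u N : nat -> R^o) b) rpredB//; exact: valP.
apply/cvg_ex; exists (Ell1 babs); apply/cvgrPdist_le => e e0.
have [N uN] := ub _ e0; exists N => // k /= Nk.
by rewrite distrC; apply: ell1_norm_le; exact: uN.
Unshelve. all: by end_near. Qed.

(** * Embeddings with closed range *)

(** The lower bound makes the inverse Lipschitz with constant [c^-1]. Thus if the images [T (u k)]
    converge, [u] is Cauchy and has a limit, which [T] sends to the limit of the images: the range
    is closed. *)
Lemma contains_copy_bounded_below (R : realType) (V X : normedModType R)
    (T : {linear V -> X}) (c : R) :
  0 < c -> (forall v, c * `|v| <= `|T v|) -> continuous T ->
  (forall u : nat -> V, cauchy (u @ \oo) -> cvgn u) ->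
  contains_copy V X.
Proof.
move=> c0 cT Tc Vc.
have cTB u v : `|u - v| <= c^-1 * `|T u - T v|.
  by rewrite ler_pdivlMl// -linearB.
(* [S] takes the default value 0 off the range, where no continuity is claimed. *)
pose S x := xget 0 [set v | T v = x].
have TK : cancel T S.
  move=> v; apply: xget_unique => //= w Twv.
  apply/eqP; rewrite -subr_eq0 -normr_le0.
  by apply: le_trans (cTB _ _) _; rewrite Twv subrr normr0 mulr0.
exists (range T); split.
- move=> y yT.
  have /choice[u uy] (k : nat) : exists v, `|y - T v| < k.+1%:R^-1.
    have k0 : 0 < k.+1%:R^-1 :> R by rewrite invr_gt0.
    have [_ [[v _ <-]]] := yT _ (nbhsx_ballx y _ k0).
    by rewrite -ball_normE; exists v.
  have Tuy : T (u k) @[k --> \oo] --> y.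
    apply/cvgrPdist_lt => e e0; near=> k; apply: lt_trans (uy k) _.
    by near: k; exact: near_infty_natSinv_lt (PosNum e0).
  have Tuc : cauchy (T (u k) @[k --> \oo]).
    by apply: cvg_cauchy; apply/cvg_ex; exists y.
  have /Vc/cvg_ex[v uv] : cauchy (u @ \oo).
    apply/cauchy_ballP => e e0.
    have /cauchy_ballP/(_ (c * e))[|[A B]/= [nA nB] ABe] := Tuc.
      exact: mulr_gt0.
    exists (T @^-1` A, T @^-1` B) => //= -[w z] [/= Aw Bz].
    have := ABe (T w, T z) (conj Aw Bz); rewrite -!ball_normE /= => Twz.
    by apply: le_lt_trans (cTB _ _) _; rewrite ltr_pdivrMl.
  exists v => //.
  have Tuv : T (u k) @[k --> \oo] --> T v.
    by apply: continuous_cvg => //; exact: Tc.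
  exact: (cvg_unique (@norm_hausdorff _ X) Tuv Tuy).
- split=> [|r _ _ [u _ <-] [v _ <-]]; first by exists 0; rewrite ?linear0.
  by exists (r *: u + v) => //; rewrite linearP.
- exists T, S; split=> //; apply/subspace_continuousP => _ [v _ <-].
  apply/cvgrPdist_lt => e e0; rewrite near_withinE.
  near=> x => -[w _ Twx]; rewrite /from_subspace -Twx !TK.
  apply: le_lt_trans (cTB _ _) _.
  rewrite Twx ltr_pdivrMl//; near: x; apply: cvgr_dist_lt; last exact: mulr_gt0.
  exact: cvg_id.
Unshelve. all: by end_near. Qed.

(** The bound [C] makes the series of [a i *: y i] absolutely convergent with sum of norm at most
    [C * |a|]; the lower estimate passes from partial sums to the limit. *)
Lemma contains_copy_ell1_of_lower_estimate (R : realType)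
    (X : completeNormedModType R) (y : nat -> X) (c C : R) :
  0 < c -> (forall n, `|y n| <= C) ->
  (forall (a : nat -> R) N,
    c * \sum_(0 <= i < N) `|a i| <= `|\sum_(0 <= i < N) a i *: y i|) ->
  contains_copy (ell1 R) X.
Proof.
move=> c0 yC cy.
pose t (a : ell1 R) : X ^nat := fun n => (a n : R) *: y n.
have C0 : 0 <= C by apply: le_trans (yC 0%N).
have tC (a : ell1 R) N : \sum_(0 <= i < N) `|t a i| <= C * `|a|.
  apply: (@le_trans _ _ (C * \sum_(0 <= i < N) `|a i|)).
    rewrite mulr_sumr; apply: ler_sum => i _.
    by rewrite /t normrZ mulrC ler_wpM2r.
  by rewrite ler_wpM2l// ell1_norm_ge_sum.
have tnc a : cvgn [normed series (t a)].
  apply: nondecreasing_is_cvgn.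
    by apply: nondecreasing_series => i _ _; exact: normr_ge0.
  by exists (C * `|a|) => _ [N _ <-]; exact: tC.
have tc a : cvgn (series (t a)) by exact: normed_cvg.
pose T (a : ell1 R) : X := limn (series (t a)).
have Tlin : linear T.
  move=> r a b; apply: cvg_lim => //.
  rewrite (_ : series _ = r \*: series (t a) \+ series (t b)); last first.
    apply/funext => N; rewrite /series /= scaler_sumr -big_split /=.
    by apply: eq_bigr => i _; rewrite /t /= scalerDl scalerA.
  by apply: cvgD; [apply: cvgZr; exact: tc | exact: tc].
pose Tl : {linear ell1 R -> X} :=
  HB.pack T (GRing.isLinear.Build _ _ _ _ T Tlin).
apply: (@contains_copy_bounded_below _ _ _ Tl c) => //.
- move=> a.
  have -> : c * `|a| = limn (c \*: abs_series a).
    by rewrite limZr//; exact: ell1_cvg.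
  rewrite /= -lim_norm//; apply: ler_lim.
  - by apply: is_cvgZr; exact: ell1_cvg.
  - by apply: is_cvg_norm; exact: tc.
  - by near=> N; exact: cy.
- apply/linear_bounded_continuous/bounded_funP => r.
  exists (C * r) => a ar; apply: (@le_trans _ _ (C * `|a|)); last first.
    by rewrite ler_wpM2l.
  apply: le_trans (lim_series_norm (tnc a)) _; apply: limr_le => //.
  by near=> N; exact: tC.
- exact: ell1_cvg_of_cauchy.
Unshelve. all: by end_near. Qed.

(** * Lower estimates from the geometry of [M] *)

Lemma disjoint_sums_lower_estimate (R : realType) (X : normedModType R)
    (D : R) (f : M -> X) (p q : nat -> posnat) (b : nat -> R) (N : nat) :
  (forall x y : M, (gdist x y)%:R <= `|f x - f y| <= D * (gdist x y)%:R) ->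
  (forall i j, p i != q j) -> (forall i, 0 <= b i) ->
  (4 - 2 * D) * \sum_(0 <= i < N) b i <=
    `|\sum_(0 <= i < N) b i *: (f (Pt (p i)) - f (Pt (q i)))|.
Proof.
(* The case [N = 0] is separate because a [Fin] vertex must be a nonempty set. *)
move=> fD pq b0; case: N => [|N]; first by rewrite !big_nil mulr0 normr0.
set n := N.+1; set s := \sum_(_ <= _ < _) b _; set z := \sum_(_ <= _ < _) _.
pose im (r : nat -> posnat) := [fset r i | i in iota 0 n]%fset.
have im_mem r i : (i < n)%N -> r i \in im r.
  have <- : (i \in iota 0 n) = (i < n)%N by rewrite mem_iota.
  by move=> ni; apply/imfsetP; exists i.
have im_neq0 r : im r != fset0 by apply/fset0Pn; exists (r 0%N); exact: im_mem.
pose A : finsubset := exist _ (im p) (im_neq0 p).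
pose B : finsubset := exist _ (im q) (im_neq0 q).
have AB0 : (im p `&` im q)%fset = fset0.
  apply/eqP/fset0Pn => -[k]; rewrite in_fsetI.
  move=> /andP[/imfsetP[i _ ->] /imfsetP[j _]].
  exact/eqP/pq.
have AB : gdist (Fin A) (Fin B) = 4%N.
  (* Distance 4 also requires [A != B]: equality would give [im p] = [im p] ∩ [im q], which is
     empty. *)
  rewrite gdistE /= AB0 eqxx; case: eqP => // /(congr1 val) /= e.
  by have := im_neq0 p; rewrite -(fsetIid (im p)) {2}e AB0 eqxx.
have fset_vertex_le r (C : finsubset) : val C = im r ->
    `|\sum_(0 <= i < n) b i *: (f (Fin C) - f (Pt (r i)))| <= D * s.
  move=> Cr; apply: le_trans (ler_norm_sum _ _ _) _.
  rewrite mulr_sumr big_nat [leRHS]big_nat.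
  apply: ler_sum => i /andP[_ ni].
  rewrite normrZ ger0_norm// mulrC ler_wpM2r//.
  have /andP[_] := fD (Fin C) (Pt (r i)).
  by rewrite gdistE /= Cr im_mem// mulr1.
have nA := fset_vertex_le p A erefl; have nB := fset_vertex_le q B erefl.
move: nA nB; set u := \sum_(_ <= _ < _) _ => nA.
set v := \sum_(_ <= _ < _) _ => nB.
have suzv : s *: (f (Fin A) - f (Fin B)) = u + z - v.
  rewrite /s scaler_suml /u /z /v -big_split -sumrB /=.
  apply: eq_bigr => i _; rewrite -scalerDr -scalerBr; congr (_ *: _).
  by rewrite addrA subrK opprB addrA subrK.
have s0 : 0 <= s by apply: sumr_ge0.
have : 4 * s <= `|u + z - v|.
  rewrite -suzv normrZ (ger0_norm s0) mulrC ler_wpM2l//.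
  by have /andP[] := fD (Fin A) (Fin B); rewrite AB.
(* [4 s <= |u| + |z| + |v| <= 2 D s + |z|]. *)
have := ler_normB (u + z) v; have := ler_normD u z.
lra.
Qed.

Theorem theorem6 (R : realType) (X : completeNormedModType R) :
  (exists D : R, 1 <= D < 2 /\
    exists f : M -> X, forall x y : M,
      (gdist x y)%:R <= `|f x - f y| <= D * (gdist x y)%:R) ->
  contains_copy (ell1 R) X.
Proof.
move=> [D [/andP[_ D2] [f fD]]].
(* [pt k] is the integer k + 1, so [g false i] is 2i + 1 and [g true i] is 2i + 2. *)
pose pt k : posnat := exist _ k.+1 (ltn0Sn k).
pose g (b : bool) i := pt (i.*2 + b)%N.
have ptI k l : pt k = pt l -> k = l by move=> /(congr1 val) [].
(* [4 - 2 * D] is positive since [D < 2]; [D * 2] arises because distinct [Pt] vertices are at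
   distance 2. *)
apply: (@contains_copy_ell1_of_lower_estimate _ _
  (fun i => f (Pt (g true i)) - f (Pt (g false i))) (4 - 2 * D) (D * 2)).
- lra.
- move=> i; have /andP[_] := fD (Pt (g true i)) (Pt (g false i)).
  rewrite gdistE /=; case: eqP => // /ptI; lia.
- move=> a N.
  have gg i j : g (0 <= a i) i != g (~~ (0 <= a j)) j.
    (* Halving gives [i = j]; parity then equates the sign test of [a i] with its own negation. *)
    apply/eqP => /ptI ij; have := congr1 odd ij; have := congr1 half ij.
    rewrite !oddD !odd_double !oddb !(addnC _.*2) !half_bit_double => <-.
    by case: (0 <= a i).
  have := disjoint_sums_lower_estimate N fD gg (fun i => normr_ge0 (a i)).
  congr (_ <= `|_|); apply: eq_bigr => i _.
  have [ai|ai] := leP 0 (a i) => /=; first by rewrite ger0_norm.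
  by rewrite ltr0_norm// scaleNr -scalerN opprB.
Qed.
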